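(* Let $\mathbb{F}$ be an arbitrary field. The $\mathbb{F}$-algebra $P_2$ (the case $n=2$ of the algebras $P_n$ described in the context) does not have a finite basis of identities.
   Context: Algebras are not necessarily associative, over a field $\mathbb{F}$. For a natural number $n\ge 1$, $P_n$ is the algebra with linear basis $a_{ij}, b_{ij}, c_i, d_{ij}, e_{ij}$, where $i,j\in\{1,\dots,n\}$, and product defined by $$a_{ij}c_i=d_{ij},\quad b_{ij}c_i=e_{ij},\quad a_{ij}e_{ij}=e_{ij}a_{ij}=-b_{ij}d_{ij}=-d_{ij}b_{ij}=c_j,$$ all other products of basis elements being zero. An identity of an algebra $A$ is an element $f(x_1,\dots,x_m)$ of the free nonassociative $\mathbb{F}$-algebra on $x_1,x_2,\dots$ such that $f(p_1,\dots,p_m)=0$ for all $p_1,\dots,p_m\in A$. A basis of identities of $A$ is a set of identities of $A$ such that every identity of $A$ is a consequence of it, i.e. lies in the smallest ideal of the free nonassociative algebra that contains this set and is invariant under all endomorphisms. *)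

(* Defs.v *)
From HB Require Import structures.
From mathcomp Require Import all_boot all_order all_algebra.
From mathcomp Require Import finmap monalg.

Set Implicit Arguments.
Unset Strict Implicit.
Unset Printing Implicit Defensive.

Import GRing.Theory.
Local Open Scope ring_scope.

(* Neither associativity nor a unit is assumed. *)
HB.mixin Record Lmodule_isNonAssocAlgebra (F : fieldType) A
    of GRing.Lmodule F A := {
  namul : A -> A -> A;
  namulDl : left_distributive namul +%R;
  namulDr : right_distributive namul +%R;
  namulZl : forall (k : F) (x y : A), namul (k *: x) y = k *: namul x y;
  namulZr : forall (k : F) (x y : A), namul x (k *: y) = k *: namul x y
}.

#[short(type="naAlgType")]
HB.structure Definition NonAssocAlgebra (F : fieldType) :=
  { A of GRing.Lmodule F A & Lmodule_isNonAssocAlgebra F A }.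

Notation "x ** y" := (namul x y) (at level 40, left associativity) : ring_scope.

(* {malg F[K]} is the F-space with basis K, and << u >> the vector of that
   space given by u : K. The product below is the bilinear extension of a
   multiplication table on the basis. *)
Section TableProduct.
Variables (F : fieldType) (K : choiceType) (t : K -> K -> {malg F[K]}).
Implicit Types f g : {malg F[K]}.

Definition table_mul f g : {malg F[K]} :=
  \sum_(u <- msupp f) \sum_(v <- msupp g) (f@_u * g@_v) *: t u v.

Lemma table_mulEw (d1 d2 : {fset K}) f g :
  (msupp f `<=` d1)%fset -> (msupp g `<=` d2)%fset ->
  table_mul f g = \sum_(u <- d1) \sum_(v <- d2) (f@_u * g@_v) *: t u v.
Proof.
move=> le1 le2; rewrite /table_mul (big_fset_incl _ le1) /=.
  apply: eq_bigr => u _; apply/big_fset_incl => // v _ /mcoeff_outdom ->.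
  by rewrite mulr0 scale0r.
move=> u _ /mcoeff_outdom fu.
by rewrite big1 // => v _; rewrite fu mul0r scale0r.
Qed.

Lemma table_mulDl : left_distributive table_mul +%R.
Proof.
move=> f g h; pose d := (msupp f `|` msupp g)%fset.
rewrite (@table_mulEw d (msupp h)) ?msuppD_le //.
rewrite (@table_mulEw d (msupp h) f) ?fsubsetUl //.
rewrite (@table_mulEw d (msupp h) g) ?fsubsetUr // -big_split /=.
apply: eq_bigr => u _; rewrite -big_split /=; apply: eq_bigr => v _.
by rewrite mcoeffD mulrDl scalerDl.
Qed.

Lemma table_mulDr : right_distributive table_mul +%R.
Proof.
move=> h f g; pose d := (msupp f `|` msupp g)%fset.
rewrite (@table_mulEw (msupp h) d) ?msuppD_le //.
rewrite (@table_mulEw (msupp h) d _ f) ?fsubsetUl //.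
rewrite (@table_mulEw (msupp h) d _ g) ?fsubsetUr // -big_split /=.
apply: eq_bigr => u _; rewrite -big_split /=; apply: eq_bigr => v _.
by rewrite mcoeffD mulrDr scalerDl.
Qed.

Lemma table_mulZl (k : F) f g : table_mul (k *: f) g = k *: table_mul f g.
Proof.
rewrite (@table_mulEw (msupp f) (msupp g)) ?msuppZ_le // scaler_sumr.
apply: eq_bigr => u _; rewrite scaler_sumr; apply: eq_bigr => v _.
by rewrite mcoeffZ scalerA mulrA.
Qed.

Lemma table_mulZr (k : F) f g : table_mul f (k *: g) = k *: table_mul f g.
Proof.
rewrite (@table_mulEw (msupp f) (msupp g)) ?msuppZ_le // scaler_sumr.
apply: eq_bigr => u _; rewrite scaler_sumr; apply: eq_bigr => v _.
by rewrite mcoeffZ scalerA mulrCA.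
Qed.

End TableProduct.

(* The unused argument t is what the instances below are keyed on. *)
Definition tableAlg (F : fieldType) (K : choiceType)
    (t : K -> K -> {malg F[K]}) : Type := {malg F[K]}.

HB.instance Definition _ (F : fieldType) (K : choiceType)
    (t : K -> K -> {malg F[K]}) := GRing.Lmodule.on (tableAlg t).
HB.instance Definition _ (F : fieldType) (K : choiceType)
    (t : K -> K -> {malg F[K]}) :=
  Lmodule_isNonAssocAlgebra.Build F (tableAlg t)
    (table_mulDl t) (table_mulDr t) (table_mulZl t) (table_mulZr t).

(* The free magma on the variables x_0, x_1, ... *)
Inductive naword := NAvar of nat | NAmul of naword & naword.

Fixpoint naword_encode (w : naword) : GenTree.tree nat :=
  match w with
  | NAvar i => GenTree.Leaf i
  | NAmul u v => GenTree.Node 0 [:: naword_encode u; naword_encode v]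
  end.

Fixpoint naword_decode (t : GenTree.tree nat) : option naword :=
  match t with
  | GenTree.Leaf i => Some (NAvar i)
  | GenTree.Node _ [:: t1; t2] =>
      if (naword_decode t1, naword_decode t2) is (Some u, Some v)
      then Some (NAmul u v) else None
  | _ => None
  end.

Lemma naword_encodeK : pcancel naword_encode naword_decode.
Proof. by elim=> //= u -> v ->. Qed.

HB.instance Definition _ := Countable.copy naword (pcan_type naword_encodeK).

Definition freeNA (F : fieldType) : Type :=
  tableAlg (fun u v : naword => << NAmul u v >> : {malg F[naword]}).

HB.instance Definition _ (F : fieldType) := NonAssocAlgebra.on (freeNA F).

Section Identities.
Variable F : fieldType.

Fixpoint naword_eval (A : naAlgType F) (p : nat -> A) (w : naword) : A :=
  match w with
  | NAvar i => p i
  | NAmul u v => naword_eval p u ** naword_eval p v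
  end.

(* f only involves finitely many of the variables, so evaluating it at a
   sequence p is the same as evaluating it at a finite tuple. *)
Definition na_eval (A : naAlgType F) (p : nat -> A) (f : freeNA F) : A :=
  \sum_(w <- msupp f) f@_w *: naword_eval p w.

Definition identity (A : naAlgType F) (f : freeNA F) : Prop :=
  forall p : nat -> A, na_eval p f = 0.

Definition is_ideal (A : naAlgType F) (I : A -> Prop) : Prop :=
  [/\ I 0,
      forall x y, I x -> I y -> I (x + y),
      forall (k : F) x, I x -> I (k *: x) &
      forall x y, I x -> I (x ** y) /\ I (y ** x)].

Definition is_T_ideal (I : freeNA F -> Prop) : Prop :=
  is_ideal I /\
  forall phi : {linear freeNA F -> freeNA F},
    {morph phi : x y / x ** y} -> forall f, I f -> I (phi f).

Definition consequence (S : freeNA F -> Prop) (f : freeNA F) : Prop :=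
  forall I : freeNA F -> Prop,
    is_T_ideal I -> (forall g, S g -> I g) -> I f.

Definition identity_basis (A : naAlgType F) (S : freeNA F -> Prop) : Prop :=
  (forall f, S f -> identity A f) /\
  (forall f, identity A f -> consequence S f).

End Identities.

Inductive Pbasis (n : nat) : Type :=
  | Pa of 'I_n & 'I_n
  | Pb of 'I_n & 'I_n
  | Pc of 'I_n
  | Pd of 'I_n & 'I_n
  | Pe of 'I_n & 'I_n.

Arguments Pa {n}. Arguments Pb {n}. Arguments Pc {n}.
Arguments Pd {n}. Arguments Pe {n}.

Definition Pbasis_code (n : nat) : Type :=
  ('I_n * 'I_n + 'I_n * 'I_n + 'I_n + 'I_n * 'I_n + 'I_n * 'I_n)%type.

HB.instance Definition _ n := Finite.on (Pbasis_code n).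

Definition Pbasis_encode n (u : Pbasis n) : Pbasis_code n :=
  match u with
  | Pa i j => inl (inl (inl (inl (i, j))))
  | Pb i j => inl (inl (inl (inr (i, j))))
  | Pc i => inl (inl (inr i))
  | Pd i j => inl (inr (i, j))
  | Pe i j => inr (i, j)
  end.

Definition Pbasis_decode n (x : Pbasis_code n) : Pbasis n :=
  match x with
  | inl (inl (inl (inl (i, j)))) => Pa i j
  | inl (inl (inl (inr (i, j)))) => Pb i j
  | inl (inl (inr i)) => Pc i
  | inl (inr (i, j)) => Pd i j
  | inr (i, j) => Pe i j
  end.

Lemma Pbasis_encodeK n : cancel (@Pbasis_encode n) (@Pbasis_decode n).
Proof. by case. Qed.

HB.instance Definition _ n :=
  Finite.copy (Pbasis n) (can_type (@Pbasis_encodeK n)).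

Definition Ptable (F : fieldType) (n : nat) (u v : Pbasis n) :
    {malg F[Pbasis n]} :=
  match u, v with
  | Pa i j, Pc k => if i == k then << Pd i j >> else 0
  | Pb i j, Pc k => if i == k then << Pe i j >> else 0
  | Pa i j, Pe k l | Pe k l, Pa i j =>
      if (i == k) && (j == l) then << Pc j >> else 0
  | Pb i j, Pd k l | Pd k l, Pb i j =>
      if (i == k) && (j == l) then - << Pc j >> else 0
  | _, _ => 0
  end.

Definition Palg (F : fieldType) (n : nat) : Type := tableAlg (@Ptable F n).

HB.instance Definition _ (F : fieldType) n := NonAssocAlgebra.on (Palg F n).

(* Main.v *)
Require Import Defs.
From mathcomp Require Import all_boot all_algebra.
From HB Require Import structures.
From mathcomp Require Import finmap monalg ring.

(* For fixed y, the operator T_x : v |-> x (y v) acts on the span of the c_i as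
   an arbitrary 2x2 matrix. Hence, for N := T_(l_1) o ... o T_(l_k), the Hall
   identity [[T_a, N] o [T_l, T_b], T_c] = 0 of 2x2 matrices produces, for each
   k, an identity of P_2 (the outer factors y _ and _ c kill the part of the
   value which is not in the span of the c_i).
   This identity is not a consequence of the identities of P_2 of degree < k.
   In P_3, with a, l_i, b, c along the edges 0 -> 1, 1 -> 1, 1 -> 2, 2 -> 2,
   only the monomial going along the path a, l_1, ..., l_k, b, c survives. Let
   l_i be 1 or 0 according to the membership of i in a subset e, and take the
   alternating sum over e, which kills polynomials of degree < k in the l_i. A
   short identity of P_2 either stays among the vertices 0, 1, or among the
   vertices 1, 2, and is then evaluated in a copy of P_2, or it connects 0 to 2
   with fewer than k loops in between, and is killed by the alternating sum. *)
Set Implicit Arguments.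
Unset Strict Implicit.
Unset Printing Implicit Defensive.

Import GRing.Theory.
Local Open Scope ring_scope.

(** * Evaluation as a homomorphism from the free algebra *)

Section Evaluation.
Variables (F : fieldType) (A : naAlgType F).
Implicit Types (p : nat -> A) (f g : freeNA F) (x y : A).

Definition var (i : nat) : freeNA F := << NAvar i >>.
Definition mon (w : naword) : freeNA F := << w >>.

Lemma namul0l x : 0 ** x = 0 :> A.
Proof. by rewrite -[0](scale0r 0) namulZl !scale0r. Qed.

Lemma namul0r x : x ** 0 = 0 :> A.
Proof. by rewrite -[0](scale0r 0) namulZr !scale0r. Qed.

Lemma namul_suml x (I : Type) (r : seq I) (h : I -> A) :
  (\sum_(i <- r) h i) ** x = \sum_(i <- r) h i ** x.
Proof.
elim/big_rec2: _ => [|i a b _ <-]; first exact: namul0l.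
by rewrite namulDl.
Qed.

Lemma namul_sumr x (I : Type) (r : seq I) (h : I -> A) :
  x ** (\sum_(i <- r) h i) = \sum_(i <- r) x ** h i.
Proof.
elim/big_rec2: _ => [|i a b _ <-]; first exact: namul0r.
by rewrite namulDr.
Qed.

Lemma na_eval_widen p f (d : {fset naword}) : (msupp f `<=` d)%fset ->
  na_eval p f = \sum_(w <- d) f@_w *: naword_eval p w.
Proof.
move=> le; rewrite /na_eval (big_fset_incl _ le) //= => w _ /mcoeff_outdom ->.
by rewrite scale0r.
Qed.

Lemma na_evalD p f g : na_eval p (f + g) = na_eval p f + na_eval p g.
Proof.
pose d := (msupp f `|` msupp g)%fset.
rewrite (@na_eval_widen p _ d) ?msuppD_le // (@na_eval_widen p f d) ?fsubsetUl //.
rewrite (@na_eval_widen p g d) ?fsubsetUr // -big_split /=.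
by apply: eq_bigr => w _; rewrite mcoeffD scalerDl.
Qed.

Lemma na_evalZ p c f : na_eval p (c *: f) = c *: na_eval p f.
Proof.
rewrite (@na_eval_widen p _ (msupp f)) ?msuppZ_le // scaler_sumr.
by apply: eq_bigr => w _; rewrite mcoeffZ scalerA.
Qed.

Lemma na_eval0 p : na_eval p 0 = 0.
Proof. by rewrite -[0](scale0r 0) na_evalZ !scale0r. Qed.

Lemma na_evalB p f g : na_eval p (f - g) = na_eval p f - na_eval p g.
Proof. by rewrite na_evalD -scaleN1r na_evalZ scaleN1r. Qed.

Lemma na_eval_sum p (I : Type) (r : seq I) (h : I -> freeNA F) :
  na_eval p (\sum_(i <- r) h i) = \sum_(i <- r) na_eval p (h i).
Proof.
elim/big_rec2: _ => [|i a b _ <-]; first exact: na_eval0.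
by rewrite na_evalD.
Qed.

Lemma na_eval_mon p w : na_eval p (mon w) = naword_eval p w.
Proof.
by rewrite (@na_eval_widen p _ [fset w]%fset) ?msuppU_le // big_seq_fset1
  mcoeffUU scale1r.
Qed.

Lemma na_eval_var p i : na_eval p (var i) = p i.
Proof. exact: na_eval_mon. Qed.

Lemma freeNA_mulE f g :
  f ** g = \sum_(u <- msupp f) \sum_(v <- msupp g)
    (f@_u * g@_v) *: mon (NAmul u v).
Proof. by []. Qed.

Lemma na_evalM p f g : na_eval p (f ** g) = na_eval p f ** na_eval p g.
Proof.
rewrite freeNA_mulE na_eval_sum {2}/na_eval namul_suml.
apply: eq_bigr => u _; rewrite na_eval_sum {2}/na_eval namul_sumr.
apply: eq_bigr => v _.
by rewrite na_evalZ na_eval_mon namulZl namulZr scalerA mulrC.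
Qed.

Lemma monM (u v : naword) : mon u ** mon v = mon (NAmul u v).
Proof.
have supp w : msupp (mon w) = [fset w]%fset by rewrite [LHS]msuppU oner_eq0.
by rewrite freeNA_mulE !supp !big_seq_fset1 !mcoeffUU mulr1 scale1r.
Qed.

Lemma freeNA_sum f : f = \sum_(w <- msupp f) f@_w *: mon w.
Proof.
rewrite {1}[f]monalgE; apply: eq_bigr => w _.
by apply/malgP => k; rewrite mcoeffZ !mcoeffU mulrnAr mulr1.
Qed.

(** An endomorphism is determined by its values on the variables, so composing it with an evaluation
    is again an evaluation. This is what makes ideals defined through evaluations stable under
    endomorphisms. *)
Lemma na_eval_subst p (phi : {linear freeNA F -> freeNA F}) f :
  {morph phi : x y / x ** y} ->
  na_eval p (phi f) = na_eval (fun i => na_eval p (phi (var i))) f.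
Proof.
move=> phiM; rewrite {1}[f]freeNA_sum linear_sum na_eval_sum.
apply: eq_bigr => w _; rewrite linearZ na_evalZ; congr (_ *: _).
elim: w => [i|u IHu v IHv] //=.
by rewrite -monM phiM na_evalM IHu IHv.
Qed.

End Evaluation.

(* Locking pcoef, pvec and proj prevents conversion from comparing elements of
   Palg F m and Palg F n by unfolding them. *)
HB.lock Definition pcoef (F : fieldType) (n : nat) (t : Pbasis n)
  (x : Palg F n) : F := x@_t.

HB.lock Definition pvec (F : fieldType) (n : nat) (t : Pbasis n)
  : Palg F n := << t >>.

(** * Coordinates of products in P_n *)

Section Coordinates.
Variables (F : fieldType) (n : nat).
Implicit Types (x y : Palg F n) (t u v : Pbasis n).

Lemma pcoefD t x y : pcoef t (x + y) = pcoef t x + pcoef t y.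
Proof. rewrite pcoef.unlock; exact: mcoeffD. Qed.

Lemma pcoefZ t c x : pcoef t (c *: x) = c * pcoef t x.
Proof. rewrite pcoef.unlock; exact: mcoeffZ. Qed.

Lemma pcoef0 t : pcoef t (0 : Palg F n) = 0.
Proof. rewrite pcoef.unlock; exact: mcoeff0. Qed.

Lemma pcoef_sum t (I : Type) (r : seq I) (h : I -> Palg F n) :
  pcoef t (\sum_(i <- r) h i) = \sum_(i <- r) pcoef t (h i).
Proof. by elim/big_rec2: _ => [|i a b _ <-]; rewrite (pcoef0, pcoefD). Qed.

Lemma pcoef_pvec t u : pcoef t (pvec F u) = (u == t)%:R.
Proof. rewrite pcoef.unlock pvec.unlock; exact: mcoeffU. Qed.

Lemma pcoef_inj x y : (forall t, pcoef t x = pcoef t y) -> x = y.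
Proof. by move=> e; apply/malgP => t; have := e t; rewrite pcoef.unlock. Qed.

Lemma pcoefB t x y : pcoef t (x - y) = pcoef t x - pcoef t y.
Proof. by rewrite pcoefD -scaleN1r pcoefZ mulN1r. Qed.

Definition of_pcoef (h : Pbasis n -> F) : Palg F n := \sum_t h t *: pvec F t.

Lemma pcoef_of_pcoef h t : pcoef t (of_pcoef h) = h t.
Proof.
rewrite pcoef_sum (bigD1 t) //= big1 => [|u ne]; rewrite pcoefZ pcoef_pvec.
  by rewrite eqxx mulr1 addr0.
by rewrite (negPf ne) mulr0.
Qed.

Lemma Palg_sum x : x = of_pcoef (fun t => pcoef t x).
Proof. by apply: pcoef_inj => t; rewrite pcoef_of_pcoef. Qed.

Lemma pvecM u v : pvec F u ** pvec F v = Ptable F u v.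
Proof.
rewrite /namul /= /table_mul.
have supp w : msupp (pvec F w) = [fset w]%fset.
  by rewrite pvec.unlock [LHS]msuppU oner_eq0.
by rewrite !supp !big_seq_fset1 pvec.unlock !mcoeffUU mulr1 scale1r.
Qed.

Lemma pcoef_namul t x y : pcoef t (x ** y) =
  \sum_u pcoef u x * \sum_v pcoef v y * pcoef t (Ptable F u v).
Proof.
rewrite {1}[x]Palg_sum namul_suml pcoef_sum; apply: eq_bigr => u _.
rewrite namulZl pcoefZ {1}[y]Palg_sum namul_sumr pcoef_sum; congr (_ * _).
by apply: eq_bigr => v _; rewrite namulZr pcoefZ pvecM.
Qed.

(** The four basis elements attached to the edge (i, j) are grouped together, which is the shape
    needed for the coordinate formula [pcoef_Pc]. *)
Lemma big_Pbasis (h : Pbasis n -> F) : \sum_t h t =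
  \sum_i \sum_j (h (Pa i j) + h (Pb i j) + h (Pd i j) + h (Pe i j)) +
  \sum_i h (Pc i).
Proof.
rewrite (reindex (@Pbasis_decode n)) /=; last first.
  apply: onW_bij; exists (@Pbasis_encode n); last exact: Pbasis_encodeK.
  by case=> [[[[[? ?]|[? ?]]|?]|[? ?]]|[? ?]].
rewrite !big_sumType /= pair_bigA !big_split /=.
have dest (c : 'I_n -> 'I_n -> Pbasis n) :
    \sum_(p : 'I_n * 'I_n) h (let (i, j) := p in c i j) =
    \sum_(p : 'I_n * 'I_n) h (c p.1 p.2).
  by apply: eq_bigr => -[].
by rewrite !dest; ring.
Qed.

(** Entries of [Ptable] have type [{malg F[Pbasis n]}] and not [Palg F n], so the coordinate rules
    are restated at that type. *)
Lemma pcoef_tab0 t : pcoef t (0 : {malg F[Pbasis n]}) = 0.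
Proof. exact: pcoef0. Qed.

Lemma pcoef_tabU t u : pcoef t (<< u >> : {malg F[Pbasis n]}) = (u == t)%:R.
Proof. by rewrite -pcoef_pvec pvec.unlock. Qed.

Lemma pcoef_tabN t u : pcoef t (- << u >> : {malg F[Pbasis n]}) = - (u == t)%:R.
Proof. by rewrite -pcoef_tabU pcoef.unlock; exact: mcoeffN. Qed.

Lemma sum_only u (h : Pbasis n -> F) :
  (forall v, v != u -> h v = 0) -> \sum_v h v = h u.
Proof. by move=> h0; rewrite (bigD1 u) //= big1 ?addr0. Qed.

(** No entry of the multiplication table contains a letter a_ij or b_ij, so a word has letter
    coordinates only when it is a single variable. *)
Lemma pcoef_Pa x y i j : pcoef (Pa i j) (x ** y) = 0.
Proof.
rewrite pcoef_namul big1 // => u _; rewrite big1 ?mulr0 // => v _.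
case: u v => [? ?|? ?|?|? ?|? ?] [? ?|? ?|?|? ?|? ?] //=; try case: ifP => _;
  by rewrite ?pcoef_tab0 ?pcoef_tabU ?pcoef_tabN ?oppr0 mulr0.
Qed.

Lemma pcoef_Pb x y i j : pcoef (Pb i j) (x ** y) = 0.
Proof.
rewrite pcoef_namul big1 // => u _; rewrite big1 ?mulr0 // => v _.
case: u v => [? ?|? ?|?|? ?|? ?] [? ?|? ?|?|? ?|? ?] //=; try case: ifP => _;
  by rewrite ?pcoef_tab0 ?pcoef_tabU ?pcoef_tabN ?oppr0 mulr0.
Qed.

Lemma pcoef_Pd x y i j : pcoef (Pd i j) (x ** y) = pcoef (Pa i j) x * pcoef (Pc i) y.
Proof.
rewrite pcoef_namul (@sum_only (Pa i j)).
  rewrite (@sum_only (Pc i)) /=; first by rewrite eqxx pcoef_tabU eqxx mulr1.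
  case=> [? ?|? ?|k|? ?|? ?] ne /=; rewrite ?pcoef_tab0 ?mulr0 //.
    case: (i =P k) ne => [->|_ _]; first by rewrite eqxx.
    by rewrite pcoef_tab0 mulr0.
  by case: ifP => _; rewrite ?pcoef_tab0 ?pcoef_tabU mulr0.
have eqd k l : (Pd k l == Pd i j) = (Pa k l == Pa i j).
  by apply/eqP/eqP => [[-> ->]|[-> ->]].
move=> u ne; rewrite big1 ?mulr0 // => v _.
case: u v ne => [? ?|? ?|?|? ?|? ?] [? ?|? ?|?|? ?|? ?] //= ne;
  try case: ifP => _;
  by rewrite ?pcoef_tab0 ?pcoef_tabU ?pcoef_tabN ?eqd ?(negPf ne) ?oppr0 mulr0.
Qed.

Lemma pcoef_Pe x y i j : pcoef (Pe i j) (x ** y) = pcoef (Pb i j) x * pcoef (Pc i) y.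
Proof.
rewrite pcoef_namul (@sum_only (Pb i j)).
  rewrite (@sum_only (Pc i)) /=; first by rewrite eqxx pcoef_tabU eqxx mulr1.
  case=> [? ?|? ?|k|? ?|? ?] ne /=; rewrite ?pcoef_tab0 ?mulr0 //.
    case: (i =P k) ne => [->|_ _]; first by rewrite eqxx.
    by rewrite pcoef_tab0 mulr0.
  by case: ifP => _; rewrite ?pcoef_tab0 ?mulr0 // pcoef_tabN mulrN mulr0 oppr0.
have eqd k l : (Pe k l == Pe i j) = (Pb k l == Pb i j).
  by apply/eqP/eqP => [[-> ->]|[-> ->]].
move=> u ne; rewrite big1 ?mulr0 // => v _.
case: u v ne => [? ?|? ?|?|? ?|? ?] [? ?|? ?|?|? ?|? ?] //= ne;
  try case: ifP => _;
  by rewrite ?pcoef_tab0 ?pcoef_tabU ?pcoef_tabN ?eqd ?(negPf ne) ?oppr0 mulr0.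
Qed.

Lemma pcoef_Pc x y j : pcoef (Pc j) (x ** y) =
  \sum_i (pcoef (Pa i j) x * pcoef (Pe i j) y + pcoef (Pe i j) x * pcoef (Pa i j) y
         - pcoef (Pb i j) x * pcoef (Pd i j) y
         - pcoef (Pd i j) x * pcoef (Pb i j) y).
Proof.
have eq_Pc (k l : 'I_n) : (Pc k == Pc l) = (k == l).
  by apply/eqP/eqP => [[]|->].
(* For a fixed left factor [u] at most one right factor yields a multiple of c_j, so the double sum
   collapses to the edges ending at j. *)
have row u : pcoef u x * (\sum_v pcoef v y * pcoef (Pc j) (Ptable F u v)) =
    match u with
    | Pa i l => if l == j then pcoef (Pa i j) x * pcoef (Pe i j) y else 0
    | Pb i l => if l == j then - (pcoef (Pb i j) x * pcoef (Pd i j) y) else 0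
    | Pc _ => 0
    | Pd i l => if l == j then - (pcoef (Pd i j) x * pcoef (Pb i j) y) else 0
    | Pe i l => if l == j then pcoef (Pe i j) x * pcoef (Pa i j) y else 0
    end.
  case: u => [i l|i l|i|i l|i l].
  - rewrite (@sum_only (Pe i l)) /=; last first.
      case=> [? ?|? ?|?|? ?|i' l'] ne /=;
        try case: ifP => [/andP[/eqP ? /eqP ?]|_]; try case: ifP => _;
      subst; rewrite ?pcoef_tab0 ?pcoef_tabU ?mulr0 //; by rewrite eqxx in ne.
    rewrite !eqxx pcoef_tabU eq_Pc; case: eqP => [->|_]; first by rewrite mulr1.
    by rewrite !mulr0.
  - rewrite (@sum_only (Pd i l)) /=; last first.
      case=> [? ?|? ?|?|i' l'|? ?] ne /=;
        try case: ifP => [/andP[/eqP ? /eqP ?]|_]; try case: ifP => _;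
      subst; rewrite ?pcoef_tab0 ?pcoef_tabU ?mulr0 //; by rewrite eqxx in ne.
    rewrite !eqxx pcoef_tabN eq_Pc; case: eqP => [->|_].
      by rewrite mulrN1 mulrN.
    by rewrite oppr0 !mulr0.
  - by rewrite big1 ?mulr0 // => -[? ?|? ?|?|? ?|? ?] _; rewrite pcoef_tab0 mulr0.
  - rewrite (@sum_only (Pb i l)) /=; last first.
      case=> [? ?|i' l'|?|? ?|? ?] ne /=;
        try case: ifP => [/andP[/eqP ? /eqP ?]|_]; try case: ifP => _;
      subst; rewrite ?pcoef_tab0 ?pcoef_tabU ?mulr0 //; by rewrite eqxx in ne.
    rewrite !eqxx pcoef_tabN eq_Pc; case: eqP => [->|_].
      by rewrite mulrN1 mulrN.
    by rewrite oppr0 !mulr0.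
  - rewrite (@sum_only (Pa i l)) /=; last first.
      case=> [i' l'|? ?|?|? ?|? ?] ne /=;
        try case: ifP => [/andP[/eqP ? /eqP ?]|_]; try case: ifP => _;
      subst; rewrite ?pcoef_tab0 ?pcoef_tabU ?mulr0 //; by rewrite eqxx in ne.
    rewrite !eqxx pcoef_tabU eq_Pc; case: eqP => [->|_]; first by rewrite mulr1.
    by rewrite !mulr0.
rewrite pcoef_namul (eq_bigr _ (fun u _ => row u)) big_Pbasis.
rewrite [X in _ + X]big1 // addr0; apply: eq_bigr => i _.
rewrite (bigD1 j) //= big1 ?eqxx => [|l ne]; first by ring.
by rewrite (negPf ne) !addr0.
Qed.

End Coordinates.

(** * The Hall-type identities of P_2 *)

Section Operators.
Variables (F : fieldType).

Definition opT (A : naAlgType F) (y x v : A) : A := x ** (y ** v).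
Definition opN (A : naAlgType F) (y : A) (s : seq A) (v : A) : A :=
  foldr (opT y) v s.
Definition opC (A : naAlgType F) (P Q : A -> A) (v : A) : A := P (Q v) - Q (P v).
(** The Jordan product without the factor 1/2, so that characteristic 2 is covered. *)
Definition opJ (A : naAlgType F) (P Q : A -> A) (v : A) : A := P (Q v) + Q (P v).

Definition opHall (A : naAlgType F) (y a l b c : A) (s : seq A) : A -> A :=
  opC (opJ (opC (opT y a) (opN y s)) (opC (opT y l) (opT y b))) (opT y c).

Definition hall (A : naAlgType F) (y a l b c z : A) (s : seq A) : A :=
  (y ** opHall y a l b c s z) ** c.

Lemma na_eval_hall (A : naAlgType F) (p : nat -> A) y a l b c z s :
  na_eval p (hall y a l b c z s) =
  hall (na_eval p y) (na_eval p a) (na_eval p l) (na_eval p b) (na_eval p c)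
    (na_eval p z) (map (na_eval p) s).
Proof.
pose simu (P : freeNA F -> freeNA F) (Q : A -> A) :=
  forall v, na_eval p (P v) = Q (na_eval p v).
have simT x : simu (opT y x) (opT (na_eval p y) (na_eval p x)).
  by move=> v; rewrite !na_evalM.
have simN : simu (opN y s) (opN (na_eval p y) (map (na_eval p) s)).
  by move=> v; elim: s => //= x s <-; exact: simT.
have simC P Q P' Q' : simu P P' -> simu Q Q' -> simu (opC P Q) (opC P' Q').
  by move=> sP sQ v; rewrite na_evalB !(sP, sQ).
have simJ P Q P' Q' : simu P P' -> simu Q Q' -> simu (opJ P Q) (opJ P' Q').
  by move=> sP sQ v; rewrite na_evalD !(sP, sQ).
rewrite !na_evalM; congr (_ ** _ ** _).
by apply: (simC); [apply: simJ; apply: simC|].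
Qed.

(** * Matrices of the operators on the span of the c_i *)

Section Matrices.
Variable n : nat.
Implicit Types (x y v : Palg F n) (M N : 'M[F]_n).

Definition cvec v : 'rV[F]_n := \row_j pcoef (Pc j) v.
(** Multiplication by y sends c_i to e_ij or d_ij, and x sends these to c_j with opposite signs;
    hence a 2x2 determinant of letter coordinates on each edge. *)
Definition edge_mx y x : 'M[F]_n := \matrix_(i, j)
  (pcoef (Pa i j) x * pcoef (Pb i j) y - pcoef (Pb i j) x * pcoef (Pa i j) y).
Definition acts (P : Palg F n -> Palg F n) M :=
  forall v, cvec (P v) = cvec v *m M.

(** Matrices act on row vectors from the right, so composing operators reverses products; the order
    of the factors here compensates for that. *)
Definition mxC M N : 'M[F]_n := N *m M - M *m N.
Definition mxJ M N : 'M[F]_n := N *m M + M *m N.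

(** The inner factor [y ** v] is a product and has no letter coordinates, so only the terms a e and
    b d contribute to c_j. *)
Lemma opT_acts y x : acts (opT y x) (edge_mx y x).
Proof.
move=> v; apply/rowP => j; rewrite !mxE pcoef_Pc; apply: eq_bigr => i _.
by rewrite !mxE pcoef_Pa pcoef_Pb pcoef_Pd pcoef_Pe; ring.
Qed.

Lemma opN_acts y s : acts (opN y s) (foldr (fun x M => M *m edge_mx y x) 1%:M s).
Proof.
by elim: s => [|x s IHs] v /=; rewrite ?mulmx1 // opT_acts IHs mulmxA.
Qed.

Lemma cvecD x y : cvec (x + y) = cvec x + cvec y.
Proof. by apply/rowP => j; rewrite !mxE pcoefD. Qed.

Lemma cvecB x y : cvec (x - y) = cvec x - cvec y.
Proof. by apply/rowP => j; rewrite !mxE pcoefB. Qed.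

Lemma opC_acts P Q M N : acts P M -> acts Q N -> acts (opC P Q) (mxC M N).
Proof. by move=> aP aQ v; rewrite cvecB !(aP, aQ) mulmxBr !mulmxA. Qed.

Lemma opJ_acts P Q M N : acts P M -> acts Q N -> acts (opJ P Q) (mxJ M N).
Proof. by move=> aP aQ v; rewrite cvecD !(aP, aQ) mulmxDr !mulmxA. Qed.

Lemma opHall_acts y a l b c s M : acts (opN y s) M ->
  acts (opHall y a l b c s)
    (mxC (mxJ (mxC (edge_mx y a) M) (mxC (edge_mx y l) (edge_mx y b)))
       (edge_mx y c)).
Proof.
move=> aN; apply: opC_acts (opT_acts _ _).
by apply: opJ_acts; apply: opC_acts => //; apply: opT_acts.
Qed.

(** If w has no c coordinates, then y w lies in the span of the c_j, and a c_j times anything on its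
    right is zero. *)
Lemma hall_eq0 y a l b c z s : cvec (opHall y a l b c s z) = 0 ->
  hall y a l b c z s = 0.
Proof.
move=> /rowP c0; rewrite /hall; set w := opHall _ _ _ _ _ _ _ in c0 *.
have {}c0 j : pcoef (Pc j) w = 0 by have := c0 j; rewrite !mxE.
apply: pcoef_inj => -[i j|i j|j|i j|i j]; rewrite ?pcoef_Pa ?pcoef_Pb ?pcoef0 //.
- rewrite pcoef_Pc big1 // => i _.
  by rewrite pcoef_Pa pcoef_Pb pcoef_Pd pcoef_Pe !c0; ring.
- by rewrite pcoef_Pd pcoef_Pa mul0r.
- by rewrite pcoef_Pe pcoef_Pb mul0r.
Qed.

End Matrices.

(** Polarized Cayley-Hamilton: a traceless 2x2 matrix satisfies M^2 = - det M. The check is made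
    entrywise. *)
Lemma mxJ_traceless (M N : 'M[F]_2) : \tr M = 0 -> \tr N = 0 ->
  exists k, mxJ M N = k%:M.
Proof.
rewrite /mxtrace !big_ord_recl !big_ord0 !addr0.
set i0 := ord0; set i1 := lift ord0 ord0 => /eqP.
rewrite addr_eq0 => /eqP M0 /eqP; rewrite addr_eq0 => /eqP N0.
exists (mxJ M N i0 i0); apply/matrixP => i j.
have mulE (P Q : 'M[F]_2) k l :
    (P *m Q) k l = P k i0 * Q i0 l + P k i1 * Q i1 l.
  by rewrite mxE !big_ord_recl big_ord0 addr0.
have ord2 (k : 'I_2) : k = i0 \/ k = i1.
  by case: k => -[|[|//]] k; [left|right]; apply: val_inj.
rewrite [RHS]mxE /mxJ ![(_ + _ : 'M_2) _ _]mxE !mulE.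
by case: (ord2 i) (ord2 j) => -> [] ->; rewrite /= ?mulr1n ?mulr0n M0 N0; ring.
Qed.

Lemma mxC_trace n (M N : 'M[F]_n) : \tr (mxC M N) = 0.
Proof. by rewrite linearB /= mxtrace_mulC subrr. Qed.

(** Commutators are traceless, so their Jordan product is a scalar matrix and commutes with the
    matrix of T_c. *)
Lemma hall_identity (y a l b c z : Palg F 2) s : hall y a l b c z s = 0.
Proof.
apply: hall_eq0; rewrite (opHall_acts _ _ _ _ (opN_acts y s)).
set J := mxJ _ _; suff [k ->] : exists k, J = k%:M.
  by rewrite /mxC scalar_mxC subrr mulmx0.
by apply: mxJ_traceless; apply: mxC_trace.
Qed.

End Operators.

(** * Alternating sums over subsets and low-degree functions *)

Section AlternatingSums.
Variables (F : fieldType) (k : nat).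
Local Notation E := {set 'I_k}.
Implicit Types (h f : E -> F) (A : E) (d : nat).

(** The set [A] records indicators already multiplied into h: a further factor [i \in e] just adds i
    to [A] ([altsum_mem]). *)
Definition altsum A h : F := \sum_(e : E | A \subset e) (-1) ^+ #|e| * h e.

(* Implied by: h is a polynomial of degree <= d in the indicators of i \in e. *)
Definition lowdeg d h := forall A, (#|A| + d < k)%N -> altsum A h = 0.
Definition is_const h := exists c, forall e, h e = c.
Definition affine h := exists c s, forall e, h e = c + \sum_(i in e) s i.

Lemma eq_altsum A h f : h =1 f -> altsum A h = altsum A f.
Proof. by move=> hf; apply: eq_bigr => e _; rewrite hf. Qed.

Lemma altsumD A h f : altsum A (fun e => h e + f e) = altsum A h + altsum A f.
Proof. by rewrite -big_split; apply: eq_bigr => e _; rewrite mulrDr. Qed.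

Lemma altsumZ A c h : altsum A (fun e => c * h e) = c * altsum A h.
Proof. by rewrite mulr_sumr; apply: eq_bigr => e _; rewrite mulrCA. Qed.

Lemma altsum0 A : altsum A (fun=> 0) = 0.
Proof. by apply: big1 => e _; rewrite mulr0. Qed.

Lemma altsum_sum A (I : Type) (r : seq I) (h : I -> E -> F) :
  altsum A (fun e => \sum_(i <- r) h i e) = \sum_(i <- r) altsum A (h i).
Proof.
rewrite exchange_big; apply: eq_bigr => e _.
by rewrite mulr_sumr.
Qed.

Lemma altsum_mem A i h :
  altsum A (fun e => (i \in e)%:R * h e) = altsum (i |: A) h.
Proof.
rewrite /altsum [RHS]big_mkcond [LHS]big_mkcond; apply: eq_bigr => e _.
rewrite subUset sub1set; case: (i \in e); case: (A \subset e) => //=.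
  by rewrite mul1r.
by rewrite mul0r mulr0.
Qed.

(** For an i outside [A], adding or removing i pairs the supersets of [A] with opposite signs. *)
Lemma altsum1 A : (#|A| < k)%N -> altsum A (fun=> 1) = 0.
Proof.
move=> ltAk; have [i iA] : exists i, i \notin A.
  apply/existsP; rewrite -negb_forall; apply: contraL ltAk => /forallP all_A.
  rewrite -leqNgt -[leqLHS]card_ord subset_leq_card //.
  by apply/subsetP => i _; apply: all_A.
rewrite /altsum (bigID (fun e : E => i \in e)) /=.
rewrite (reindex_onto (fun e : E => i |: e) (fun e => e :\ i)) /=; last first.
  by move=> e /andP[_ ie]; rewrite setD1K.
rewrite (eq_big (fun e : E => (A \subset e) && (i \notin e))
  (fun e => - ((-1) ^+ #|e| * 1 : F))).
- by rewrite sumrN addNr.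
- move=> e; rewrite setU11 andbT; have [ie|ie] := boolP (i \in e).
    rewrite andbF; apply/andP => -[_ /eqP e_i].
    by move: ie; rewrite -e_i !inE eqxx.
  rewrite setU1K // eqxx !andbT.
  apply/subsetP/subsetP => sub x xA; last by rewrite setU1r ?sub.
  by have := sub x xA; rewrite !inE; case/predU1P => // xi; rewrite -xi xA in iA.
- move=> e /andP[_ /eqP e_i].
  have ie : i \notin e by rewrite -e_i !inE eqxx.
  by rewrite cardsU1 ie exprS mulN1r mulNr.
Qed.

Lemma eq_lowdeg d h f : h =1 f -> lowdeg d h -> lowdeg d f.
Proof. by move=> hf lh A ltA; rewrite -(eq_altsum A hf) lh. Qed.

Lemma lowdeg_const d h : is_const h -> lowdeg d h.
Proof.
move=> [c hc] A ltA; rewrite (@eq_altsum A _ (fun=> c * 1)).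
  by rewrite altsumZ altsum1 ?mulr0 // (leq_ltn_trans _ ltA) ?leq_addr.
by move=> e; rewrite hc mulr1.
Qed.

Lemma lowdegD d h f : lowdeg d h -> lowdeg d f -> lowdeg d (fun e => h e + f e).
Proof. by move=> lh lf A ltA; rewrite altsumD lh ?lf ?addr0. Qed.

Lemma lowdegZ d c h : lowdeg d h -> lowdeg d (fun e => c * h e).
Proof. by move=> lh A ltA; rewrite altsumZ lh ?mulr0. Qed.

Lemma lowdeg0 d : lowdeg d (fun=> 0).
Proof. by move=> A _; exact: altsum0. Qed.

Lemma lowdeg_sum d (I : eqType) (r : seq I) (h : I -> E -> F) :
  (forall i, i \in r -> lowdeg d (h i)) ->
  lowdeg d (fun e => \sum_(i <- r) h i e).
Proof.
move=> lh A ltA; rewrite altsum_sum big_seq big1 // => i ir.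
exact: lh.
Qed.

Lemma lowdegW d d' h : (d <= d')%N -> lowdeg d h -> lowdeg d' h.
Proof.
move=> le lh A ltA; apply: lh; apply: leq_ltn_trans ltA.
by rewrite leq_add2l.
Qed.

(** Each indicator in the affine factor enlarges [A] by at most one element, and the extra unit of
    degree pays for it. *)
Lemma lowdegM_affine d h f :
  affine h -> lowdeg d f -> lowdeg d.+1 (fun e => h e * f e).
Proof.
move=> [c [s hE]] lf A ltA.
pose g i (e : E) := s i * ((i \in e)%:R * f e).
rewrite (@eq_altsum A _ (fun e => c * f e + \sum_i g i e)).
  have ltA' : (#|A| + d < k)%N by rewrite (leq_trans _ ltA) // ltnS leq_add2l.
  rewrite altsumD altsumZ lf // mulr0 add0r altsum_sum big1 // => i _.
  rewrite altsumZ altsum_mem lf ?mulr0 //; apply: leq_ltn_trans ltA.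
  by rewrite addnS -addSn leq_add2r cardsU1; case: (i \notin A).
move=> e; rewrite hE mulrDl mulr_suml big_mkcond /=; congr (_ + _).
apply: eq_bigr => i _; rewrite /g.
by case: (i \in e); rewrite ?mul1r // mul0r mulr0.
Qed.

Lemma constM h f : is_const h -> is_const f -> is_const (fun e => h e * f e).
Proof. by move=> [c hc] [c' fc]; exists (c * c') => e; rewrite hc fc. Qed.

Lemma constD h f : is_const h -> is_const f -> is_const (fun e => h e + f e).
Proof. by move=> [c hc] [c' fc]; exists (c + c') => e; rewrite hc fc. Qed.

Lemma constZ c h : is_const h -> is_const (fun e => c * h e).
Proof. by move=> [c' hc]; exists (c * c') => e; rewrite hc. Qed.

Lemma affineD h f : affine h -> affine f -> affine (fun e => h e + f e).
Proof.
move=> [c [s hE]] [c' [s' fE]]; exists (c + c'), (fun i => s i + s' i) => e.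
by rewrite hE fE big_split /= addrACA.
Qed.

Lemma affineZ c h : affine h -> affine (fun e => c * h e).
Proof.
move=> [c' [s hE]]; exists (c * c'), (fun i => c * s i) => e.
by rewrite hE mulrDr mulr_sumr.
Qed.

Lemma const_affine h : is_const h -> affine h.
Proof.
by move=> [c hc]; exists c, (fun=> 0) => e; rewrite hc big1 ?addr0.
Qed.

Lemma altsumM_const A h f : is_const h -> altsum A f = 0 ->
  altsum A (fun e => h e * f e) = 0.
Proof.
move=> [c hc] f0; rewrite (@eq_altsum A _ (fun e => c * f e)).
  by rewrite altsumZ f0 mulr0.
by move=> e; rewrite hc.
Qed.

(** The product of all k indicators is supported on the full set, which contributes a single
    sign. *)
Lemma altsum_prod_mem : altsum set0 (fun e : E => \prod_i (i \in e)%:R) != 0.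
Proof.
rewrite /altsum (bigD1 setT) ?sub0set //= [X in _ + X]big1 => [|e /andP[_ ne]].
  rewrite addr0 big1 ?mulr1 ?signr_eq0 // => i _.
  by rewrite in_setT.
have [i ie] : exists i, i \notin e.
  apply/existsP; rewrite -negb_forall; apply: contra ne => /forallP all_e.
  by apply/eqP/setP => i; rewrite in_setT; apply: all_e.
by rewrite (bigD1 i) //= (negPf ie) mul0r mulr0.
Qed.

End AlternatingSums.

(** * Restriction to a subset of the vertices *)

Definition vmap (m n : nat) (s : 'I_m -> 'I_n) (t : Pbasis m) : Pbasis n :=
  match t with
  | Pa i j => Pa (s i) (s j)
  | Pb i j => Pb (s i) (s j)
  | Pc j => Pc (s j)
  | Pd i j => Pd (s i) (s j)
  | Pe i j => Pe (s i) (s j)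
  end.

HB.lock Definition proj (F : fieldType) (m n : nat) (s : 'I_m -> 'I_n)
  (x : Palg F n) : Palg F m := of_pcoef (fun t => pcoef (vmap s t) x).

Section Projection.
Variables (F : fieldType) (m n : nat) (s : 'I_m -> 'I_n).
Implicit Types (x y : Palg F n) (t : Pbasis m).

Lemma pcoef_proj t x : pcoef t (proj s x) = pcoef (vmap s t) x.
Proof. by rewrite proj.unlock pcoef_of_pcoef. Qed.

Lemma projM_Pd x y i j :
  pcoef (Pd (s i) (s j)) (x ** y) = pcoef (Pd i j) (proj s x ** proj s y).
Proof. by rewrite !pcoef_Pd !pcoef_proj. Qed.

Lemma projM_Pe x y i j :
  pcoef (Pe (s i) (s j)) (x ** y) = pcoef (Pe i j) (proj s x ** proj s y).
Proof. by rewrite !pcoef_Pe !pcoef_proj. Qed.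

(** For injective [s], this is the formula for the coordinate at c_(s j) of [x ** y] with the
    vertices outside the image of [s] left out; that omission is the only obstruction to [proj s]
    being multiplicative. *)
Lemma projM_Pc x y j :
  pcoef (Pc j) (proj s x ** proj s y) =
  \sum_i (pcoef (Pa (s i) (s j)) x * pcoef (Pe (s i) (s j)) y
         + pcoef (Pe (s i) (s j)) x * pcoef (Pa (s i) (s j)) y
         - pcoef (Pb (s i) (s j)) x * pcoef (Pd (s i) (s j)) y
         - pcoef (Pd (s i) (s j)) x * pcoef (Pb (s i) (s j)) y).
Proof. by rewrite pcoef_Pc; apply: eq_bigr => i _; rewrite !pcoef_proj. Qed.

End Projection.

(** * Families in P_3 indexed by subsets: admissible and negligible ones *)

Section Families.
Variables (F : fieldType) (k : nat).
Local Notation E := {set 'I_k}.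
Implicit Types (u v : E -> Palg F 3) (t : Pbasis 3).

(** On the vertices 0, 1, 2 this leaves the loops and the steps 0 -> 1 and 1 -> 2, so each edge lies
    within {0, 1} or within {1, 2}. *)
Definition edge (i j : nat) : bool := (i <= j <= i.+1)%N.

Definition offedge t : bool :=
  match t with
  | Pa i j | Pb i j | Pd i j | Pe i j => ~~ edge i j
  | Pc _ => false
  end.

Definition letter t : bool :=
  match t with Pa _ _ | Pb _ _ => true | _ => false end.

(* The coordinates that do not involve the loop at 1: the letters over the other
   edges, and the values reached while still at the vertex 0. *)
Definition rigid t : bool :=
  match t with
  | Pa i j | Pb i j => (i != 1 :> nat) || (j != 1 :> nat)
  | Pc i | Pd i _ | Pe i _ => i == 0 :> nat
  end.

Definition late t : bool :=
  match t with
  | Pa _ _ | Pb _ _ => false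
  | Pc j | Pd _ j | Pe _ j => j == 2 :> nat
  end.

(** Chosen to be closed under the algebra operations and to contain the substitution [point] used to
    refute the witness. *)
Definition admissible u : Prop :=
  [/\ forall t e, offedge t -> pcoef t (u e) = 0,
      forall t, rigid t -> is_const (fun e => pcoef t (u e)) &
      forall t, letter t -> affine (fun e => pcoef t (u e))].

(** Chosen to be an ideal relative to the admissible families. The sum over all subsets suffices,
    because past this stage the only available letters, those into vertex 2, are constant in e. *)
Definition negligible v : Prop :=
  (forall t e, ~~ late t -> pcoef t (v e) = 0) /\
  (forall t, altsum set0 (fun e => pcoef t (v e)) = 0).

Lemma const0 (h : E -> F) : (forall e, h e = 0) -> is_const h.
Proof. by exists 0. Qed.

Lemma admissible0 : admissible (fun=> 0).
Proof.
split=> [t e _|t _|t _]; first exact: pcoef0.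
  by apply: const0 => e; exact: pcoef0.
by apply/const_affine/const0 => e; exact: pcoef0.
Qed.

Lemma admissibleD u v : admissible u -> admissible v ->
  admissible (fun e => u e + v e).
Proof.
move=> [u1 u2 u3] [v1 v2 v3]; split=> [t e off|t /[dup] /u2 [c uE] /v2 [c' vE]|].
- by rewrite pcoefD u1 ?v1 ?addr0.
- by exists (c + c') => e; rewrite pcoefD uE vE.
move=> t l; have [c [s E1]] := affineD (u3 t l) (v3 t l).
by exists c, s => e; rewrite pcoefD E1.
Qed.

Lemma admissibleZ a u : admissible u -> admissible (fun e => a *: u e).
Proof.
move=> [u1 u2 u3]; split=> [t e off|t /u2 [c uE]|].
- by rewrite pcoefZ u1 ?mulr0.
- by exists (a * c) => e; rewrite pcoefZ uE.
move=> t l; have [c [s E1]] := affineZ a (u3 t l).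
by exists c, s => e; rewrite pcoefZ E1.
Qed.

Lemma eq_const (h f : E -> F) : h =1 f -> is_const h -> is_const f.
Proof. by move=> hf [c hc]; exists c => e; rewrite -hf. Qed.

(** Products have no letter coordinates, which settles affinity; rigid coordinates of a product are
    polynomials in rigid coordinates of the factors. *)
Lemma admissibleM u v : admissible u -> admissible v ->
  admissible (fun e => u e ** v e).
Proof.
move=> qu qv; case: (qu) (qv) => [u1 u2 u3] [v1 v2 v3]; split.
- case=> [i j|i j|j|i j|i j] e //= off; rewrite ?pcoef_Pa ?pcoef_Pb //.
    by rewrite pcoef_Pd u1 ?mul0r.
  by rewrite pcoef_Pe u1 ?mul0r.
- case=> [i j|i j|j|i j|i j] /= r.
  + by apply: const0 => e; exact: pcoef_Pa.
  + by apply: const0 => e; exact: pcoef_Pb.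
  (* Here j is 0, and no edge leads from another vertex back to 0, so only the loop at 0
     contributes. *)
  + have e0 (w : E -> Palg F 3) : admissible w ->
        forall (i : 'I_3) e, i != 0 :> nat ->
        pcoef (Pa i j) (w e) = 0 /\ pcoef (Pb i j) (w e) = 0.
      move=> [w1 _ _] i e i0; have off : ~~ edge i j.
        by rewrite (eqP r) /edge leqn0 (negPf i0).
      by split; apply: w1.
    pose z : 'I_3 := ord0.
    apply: (@eq_const (fun e => pcoef (Pa z j) (u e) * pcoef (Pe z j) (v e)
       + pcoef (Pe z j) (u e) * pcoef (Pa z j) (v e)
       + - 1 * (pcoef (Pb z j) (u e) * pcoef (Pd z j) (v e))
       + - 1 * (pcoef (Pd z j) (u e) * pcoef (Pb z j) (v e)))).
      move=> e; rewrite pcoef_Pc big_ord_recl big1 => [|i _]; first by ring.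
      have [-> ->] := e0 u qu (lift ord0 i) e isT.
      have [-> ->] := e0 v qv (lift ord0 i) e isT.
      by ring.
    by do ![apply: constD]; try apply: constZ; apply: constM;
      do 1?[apply: u2|apply: v2].
  + apply: (@eq_const (fun e => pcoef (Pa i j) (u e) * pcoef (Pc i) (v e))).
      by move=> e; rewrite pcoef_Pd.
    by apply: constM; [apply: u2|apply: v2]; rewrite //= (eqP r).
  + apply: (@eq_const (fun e => pcoef (Pb i j) (u e) * pcoef (Pc i) (v e))).
      by move=> e; rewrite pcoef_Pe.
    by apply: constM; [apply: u2|apply: v2]; rewrite //= (eqP r).
case=> [i j|i j|j|i j|i j] //= _; apply: const_affine; apply: const0 => e.
  exact: pcoef_Pa.
exact: pcoef_Pb.
Qed.

Lemma admissible_word (p : E -> nat -> Palg F 3) w :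
  (forall i, admissible (fun e => p e i)) ->
  admissible (fun e => naword_eval (p e) w).
Proof. by move=> qp; elim: w => [i|w1 q1 w2 q2] //=; apply: admissibleM. Qed.

Lemma admissible_eval (p : E -> nat -> Palg F 3) f :
  (forall i, admissible (fun e => p e i)) -> admissible (fun e => na_eval (p e) f).
Proof.
move=> qp; rewrite /na_eval; elim: (enum_fset _) => [|w s IHs].
  have [q1 q2 q3] := admissible0; split=> [t e off|t /q2[c hc]|t /q3[c [s hs]]].
  - by rewrite big_nil q1.
  - by exists c => e; rewrite big_nil (hc e).
  - by exists c, s => e; rewrite big_nil (hs e).
have [q1 q2 q3] := admissibleD (admissibleZ f@_w (admissible_word w qp)) IHs.
split=> [t e off|t /q2[c hc]|t /q3[c [s' hs]]].
- by rewrite big_cons q1.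
- by exists c => e; rewrite big_cons -(hc e).
- by exists c, s' => e; rewrite big_cons -(hs e).
Qed.

Lemma negligible0 : negligible (fun=> 0).
Proof.
split=> [t e _|t]; first exact: pcoef0.
by rewrite (@eq_altsum _ _ _ _ (fun=> 0)) ?altsum0 // => e; exact: pcoef0.
Qed.

Lemma negligibleD u v : negligible u -> negligible v ->
  negligible (fun e => u e + v e).
Proof.
move=> [u1 u2] [v1 v2]; split=> [t e lt|t].
  by rewrite pcoefD u1 ?v1 ?addr0.
rewrite (@eq_altsum _ _ _ _ (fun e => pcoef t (u e) + pcoef t (v e))).
  by rewrite altsumD u2 v2 addr0.
by move=> e; exact: pcoefD.
Qed.

Lemma negligibleZ a u : negligible u -> negligible (fun e => a *: u e).
Proof.
move=> [u1 u2]; split=> [t e lt|t]; first by rewrite pcoefZ u1 ?mulr0.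
rewrite (@eq_altsum _ _ _ _ (fun e => a * pcoef t (u e))).
  by rewrite altsumZ u2 mulr0.
by move=> e; exact: pcoefZ.
Qed.

Lemma eq_inJ u v : u =1 v -> negligible u -> negligible v.
Proof.
move=> uv [u1 u2]; split=> [t e lt|t]; first by rewrite -uv u1.
by rewrite -(u2 t); apply: eq_altsum => e; rewrite uv.
Qed.

(** The family v is concentrated at vertex 2, which only its loop leaves; letters into 2 are rigid,
    so the alternating sums get multiplied by constants. *)
Lemma negligible_ideal u v : admissible u -> negligible v ->
  negligible (fun e => u e ** v e) /\ negligible (fun e => v e ** u e).
Proof.
move=> [u1 u2 u3] [v1 v2]; have va i j e : pcoef (Pa i j) (v e) = 0 by exact: v1.
have vb i j e : pcoef (Pb i j) (v e) = 0 by exact: v1.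
have uv_late t e : ~~ late t -> pcoef t (u e ** v e) = 0.
  case: t => [i j|i j|j|i j|i j] /= lt; rewrite ?pcoef_Pa ?pcoef_Pb //.
  - rewrite pcoef_Pc big1 // => i _; rewrite va vb (v1 (Pd i j)) // (v1 (Pe i j)) //.
    by ring.
  - rewrite pcoef_Pd; have [i2|i2] := boolP (i == 2 :> nat).
      rewrite u1 ?mul0r //= /edge (eqP i2).
      by case: j lt => -[|[|[]]].
    by rewrite v1 ?mulr0.
  - rewrite pcoef_Pe; have [i2|i2] := boolP (i == 2 :> nat).
      rewrite u1 ?mul0r //= /edge (eqP i2).
      by case: j lt => -[|[|[]]].
    by rewrite v1 ?mulr0.
have uv_sum t : altsum set0 (fun e => pcoef t (u e ** v e)) = 0.
  have [lt|nlt] := boolP (late t); last first.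
    by rewrite (@eq_altsum _ _ _ _ (fun=> 0)) ?altsum0 // => e; exact: uv_late.
  case: t lt => [i j|i j|j|i j|i j] //= /eqP j2.
  - rewrite (@eq_altsum _ _ _ _ (fun e =>
        \sum_i (pcoef (Pa i j) (u e) * pcoef (Pe i j) (v e)
               + -1 * (pcoef (Pb i j) (u e) * pcoef (Pd i j) (v e))))).
      rewrite altsum_sum big1 // => i _; rewrite altsumD altsumZ.
      by rewrite !altsumM_const ?mulr0 ?addr0 //; apply: u2; rewrite /= j2 orbT.
    by move=> e; rewrite pcoef_Pc; apply: eq_bigr => i _; rewrite va vb; ring.
  - rewrite (@eq_altsum _ _ _ _ (fun e =>
        pcoef (Pa i j) (u e) * pcoef (Pc i) (v e))).
      by rewrite altsumM_const //; apply: u2; rewrite /= j2 orbT.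
    by move=> e; exact: pcoef_Pd.
  - rewrite (@eq_altsum _ _ _ _ (fun e =>
        pcoef (Pb i j) (u e) * pcoef (Pc i) (v e))).
      by rewrite altsumM_const //; apply: u2; rewrite /= j2 orbT.
    by move=> e; exact: pcoef_Pe.
(* The c coordinates of a product are symmetric in the factors, and the d and e coordinates vanish
   because v has no letters. *)
have vuE t e : pcoef t (v e ** u e) = if t is Pc _ then pcoef t (u e ** v e) else 0.
  case: t => [i j|i j|j|i j|i j].
  - exact: pcoef_Pa.
  - exact: pcoef_Pb.
  - rewrite [LHS]pcoef_Pc [RHS]pcoef_Pc; apply: eq_bigr => i _.
    rewrite va vb !mul0r !mulr0 add0r !addr0 !subr0.
    by rewrite mulrC (mulrC (pcoef _ (v e))).
  - by rewrite pcoef_Pd va mul0r.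
  - by rewrite pcoef_Pe vb mul0r.
split; split.
- by move=> t e; exact: uv_late.
- by move=> t; exact: uv_sum.
- by move=> t e lt; rewrite vuE; case: t lt => // j lt; exact: uv_late.
move=> t; rewrite (eq_altsum _ (vuE t)).
by case: t => [i j|i j|j|i j|i j]; first [exact: uv_sum | exact: altsum0].
Qed.

Definition low : 'I_2 -> 'I_3 := widen_ord (leqnSn 2).
Definition high : 'I_2 -> 'I_3 := lift ord0.

(** The omitted vertex is 2, and no edge leads from 2 to 0 or 1. *)
Lemma proj_lowM u v e : admissible u -> admissible v ->
  proj low (u e ** v e) = proj low (u e) ** proj low (v e).
Proof.
move=> [u1 _ _] [v1 _ _]; apply: pcoef_inj => t; rewrite pcoef_proj.
case: t => [i j|i j|j|i j|i j].
- by rewrite [LHS]pcoef_Pa [RHS]pcoef_Pa.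
- by rewrite [LHS]pcoef_Pb [RHS]pcoef_Pb.
- rewrite projM_Pc [LHS]pcoef_Pc big_ord_recr /= [X in _ + X](_ : _ = 0) ?addr0 //.
  have off : ~~ edge (ord_max : 'I_3) (low j) by case: j => -[|[]].
  rewrite (u1 (Pa _ _)) // (u1 (Pb _ _)) // (v1 (Pa _ _)) // (v1 (Pb _ _)) //.
  by rewrite !mul0r !mulr0 addr0 !subr0.
- exact: projM_Pd.
- exact: projM_Pe.
Qed.

Lemma proj_low_word (p : E -> nat -> Palg F 3) w e :
  (forall i, admissible (fun e => p e i)) ->
  proj low (naword_eval (p e) w) = naword_eval (fun i => proj low (p e i)) w.
Proof.
move=> qp; elim: w => [i|w1 IH1 w2 IH2] //=.
by rewrite -IH1 -IH2 -(proj_lowM e (admissible_word w1 qp) (admissible_word w2 qp)).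
Qed.

Fixpoint wsize (w : naword) : nat :=
  if w is NAmul w1 w2 then wsize w1 + wsize w2 else 1.

Lemma wsize_gt0 w : (0 < wsize w)%N.
Proof. by elim: w => //= w1 s1 w2 _; rewrite addn_gt0 s1. Qed.

(* Restricting to the vertices 1 and 2 is multiplicative up to the contribution
   of paths coming from 0, which has low degree in the loops at 1. *)
Definition defect (p : E -> nat -> Palg F 3) w (t : Pbasis 2) e : F :=
  pcoef (vmap high t) (naword_eval (p e) w) -
  pcoef t (naword_eval (fun i => proj high (p e i)) w).

Lemma defect_letter p w (t : Pbasis 2) e : letter (vmap high t) ->
  defect p w t e = 0.
Proof.
rewrite /defect; case: w => [i|w1 w2] /=; first by rewrite pcoef_proj subrr.
by case: t => // i j _ /=; rewrite ?pcoef_Pa ?pcoef_Pb subrr.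
Qed.

(** Induction on w: the defect of a product is a constant plus sums of an affine letter times the
    defect of one factor. The other factor has size at least 1, which absorbs the increase in
    degree. *)
Lemma lowdeg_defect p w (t : Pbasis 2) :
  (forall i, admissible (fun e => p e i)) -> lowdeg (wsize w) (defect p w t).
Proof.
move=> qp; elim: w t => [i|w1 IH1 w2 IH2] t.
  apply: (eq_lowdeg (h := fun=> 0)); last exact: lowdeg0.
  by move=> e; rewrite /defect /= pcoef_proj subrr.
have [q1 a1 f1] := admissible_word w1 qp; have [q2 a2 f2] := admissible_word w2 qp.
pose p' e i := proj high (p e i).
have ltr w (s : Pbasis 2) e : letter (vmap high s) ->
    pcoef s (naword_eval (p' e) w) = pcoef (vmap high s) (naword_eval (p e) w).
  by move=> l; have /eqP := defect_letter p w e l; rewrite subr_eq0 => /eqP.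
have mul2 h s : affine h ->
    lowdeg (wsize w1 + wsize w2) (fun e => h e * defect p w2 s e).
  move=> ah; apply: (@lowdegW _ _ (wsize w2).+1).
    by rewrite -add1n leq_add2r wsize_gt0.
  exact: lowdegM_affine.
have mul1 h s : affine h ->
    lowdeg (wsize w1 + wsize w2) (fun e => h e * defect p w1 s e).
  move=> ah; apply: (@lowdegW _ _ (wsize w1).+1).
    by rewrite -addn1 leq_add2l wsize_gt0.
  exact: lowdegM_affine.
case: t => [i j|i j|j|i j|i j].
- apply: (eq_lowdeg (h := fun=> 0)) => [e|]; last exact: lowdeg0.
  by rewrite defect_letter.
- apply: (eq_lowdeg (h := fun=> 0)) => [e|]; last exact: lowdeg0.
  by rewrite defect_letter.
- pose z : 'I_3 := ord0.
  (* The contribution of the omitted vertex 0. All of its coordinates are rigid, so it does not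
     depend on e. *)
  pose h0 e :=
    pcoef (Pa z (high j)) (naword_eval (p e) w1) *
      pcoef (Pe z (high j)) (naword_eval (p e) w2) +
    pcoef (Pe z (high j)) (naword_eval (p e) w1) *
      pcoef (Pa z (high j)) (naword_eval (p e) w2) +
    -1 * (pcoef (Pb z (high j)) (naword_eval (p e) w1) *
      pcoef (Pd z (high j)) (naword_eval (p e) w2)) +
    -1 * (pcoef (Pd z (high j)) (naword_eval (p e) w1) *
      pcoef (Pb z (high j)) (naword_eval (p e) w2)).
  apply: (eq_lowdeg (h := fun e => h0 e + \sum_i
    (pcoef (Pa (high i) (high j)) (naword_eval (p e) w1) *
       defect p w2 (Pe i j) e +
     pcoef (Pa (high i) (high j)) (naword_eval (p e) w2) *
       defect p w1 (Pe i j) e +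
     -1 * (pcoef (Pb (high i) (high j)) (naword_eval (p e) w1) *
       defect p w2 (Pd i j) e) +
     -1 * (pcoef (Pb (high i) (high j)) (naword_eval (p e) w2) *
       defect p w1 (Pd i j) e)))).
    move=> e; rewrite [in RHS]/defect /= pcoef_Pc [in RHS]big_ord_recl.
    rewrite [in RHS]pcoef_Pc -[RHS]addrA; congr (_ + _); first by rewrite /h0; ring.
    rewrite -sumrB; apply: eq_bigr => i _; rewrite -/(high i).
    rewrite !(ltr _ (Pa i j)) // !(ltr _ (Pb i j)) // /defect /=.
    by ring.
  apply: lowdegD.
    apply: lowdeg_const.
    by do ![apply: constD]; try apply: constZ; apply: constM;
      do 1?[apply: a1|apply: a2].
  apply: lowdeg_sum => i _.
  by do ![apply: lowdegD]; try apply: lowdegZ;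
    first [apply: mul2 | apply: mul1]; do 1?[apply: f1 | apply: f2].
- apply: (eq_lowdeg (h := fun e =>
    pcoef (Pa (high i) (high j)) (naword_eval (p e) w1) *
       defect p w2 (Pc i) e)).
    by move=> e; rewrite /defect /= !pcoef_Pd (ltr _ (Pa i j)) // mulrBr.
  by apply: mul2; apply: f1.
- apply: (eq_lowdeg (h := fun e =>
    pcoef (Pb (high i) (high j)) (naword_eval (p e) w1) *
       defect p w2 (Pc i) e)).
    by move=> e; rewrite /defect /= !pcoef_Pe (ltr _ (Pb i j)) // mulrBr.
  by apply: mul2; apply: f1.
Qed.

End Families.

(** * Covering P_3 by two copies of P_2 *)

Lemma lowP (i : 'I_3) : i != 2 :> nat -> exists i', i = low i'.
Proof.
case: i => -[|[|[|//]]] lti // _; first by exists ord0; apply: val_inj.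
by exists ord_max; apply: val_inj.
Qed.

Lemma highP (i : 'I_3) : i != 0 :> nat -> exists i', i = high i'.
Proof.
case: i => -[|[|[|//]]] lti // _; first by exists ord0; apply: val_inj.
by exists ord_max; apply: val_inj.
Qed.

Lemma edge_low (i j : 'I_3) : edge i j -> j != 2 :> nat -> i != 2 :> nat.
Proof.
move=> /andP[le _] j2; apply: contra j2 => /eqP i2.
by rewrite i2 in le; case: j le => -[|[|[]]].
Qed.

Lemma edge_high (i j : 'I_3) : edge i j -> j == 2 :> nat -> i != 0 :> nat.
Proof. by move=> /andP[_ le] /eqP j2; rewrite j2 ltnS in le; case: (val i) le. Qed.

(** An edge ending before 2 also starts before 2, and an edge ending at 2 does not start at 0. *)
Lemma basis_cover (t : Pbasis 3) :
  [\/ offedge t, exists t', t = vmap low t' |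
      exists2 t', t = vmap high t' & letter t || late t].
Proof.
have [off|on] := boolP (offedge t); first by constructor 1.
have two (i j : 'I_3) : edge i j -> (exists i' j', i = low i' /\ j = low j') \/
    (exists i' j', i = high i' /\ j = high j') /\ j == 2 :> nat.
  move=> ij; have [j2|j2] := boolP (j == 2 :> nat); [right|left].
    have [i' ->] := highP (edge_high ij j2).
    have [|j' ->] := @highP j; first by rewrite (eqP j2).
    by split=> //; exists i', j'.
  have [i' ->] := lowP (edge_low ij j2); have [j' ->] := lowP j2.
  by exists i', j'.
case: t on => [i j|i j|j|i j|i j] /= on; last 2 first.
- case/negPn/two: on => [[i' [j' [-> ->]]]|[[i' [j' [-> ->]]] j2]].
    by constructor 2; exists (Pd i' j').
  by constructor 3; exists (Pd i' j').
- case/negPn/two: on => [[i' [j' [-> ->]]]|[[i' [j' [-> ->]]] j2]].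
    by constructor 2; exists (Pe i' j').
  by constructor 3; exists (Pe i' j').
- case/negPn/two: on => [[i' [j' [-> ->]]]|[[i' [j' [-> ->]]] j2]].
    by constructor 2; exists (Pa i' j').
  by constructor 3; exists (Pa i' j').
- case/negPn/two: on => [[i' [j' [-> ->]]]|[[i' [j' [-> ->]]] j2]].
    by constructor 2; exists (Pb i' j').
  by constructor 3; exists (Pb i' j').
have [j2|j2] := boolP (j == 2 :> nat).
  have [|j' ej] := @highP j; first by rewrite (eqP j2).
  by constructor 3; exists (Pc j'); rewrite ?ej.
by have [j' ->] := lowP j2; constructor 2; exists (Pc j').
Qed.

(** * Short identities of P_2 take negligible values *)

Section ShortIdentities.
Variables (F : fieldType) (k : nat).
Local Notation E := {set 'I_k}.
Variables (p : E -> nat -> Palg F 3) (g : freeNA F).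
Hypothesis qp : forall i, admissible (fun e => p e i).
Hypothesis g_id : identity (Palg F 2) g.

Lemma pcoef_eval n (q : nat -> Palg F n) t :
  pcoef t (na_eval q g) = \sum_(w <- msupp g) g@_w * pcoef t (naword_eval q w).
Proof. by rewrite pcoef_sum; apply: eq_bigr => w _; rewrite pcoefZ. Qed.

Lemma pcoef_low t e : pcoef (vmap low t) (na_eval (p e) g) = 0.
Proof.
rewrite pcoef_eval -[RHS](pcoef0 F t) -(g_id (fun i => proj low (p e i))) pcoef_eval.
by apply: eq_bigr => w _; rewrite -proj_low_word // pcoef_proj.
Qed.

(** Subtracting the value of g in the copy of P_2 on {1, 2}, which is zero, replaces every word by
    its defect. *)
Lemma pcoef_high t e :
  pcoef (vmap high t) (na_eval (p e) g) = \sum_(w <- msupp g) g@_w * defect p w t e.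
Proof.
rewrite pcoef_eval -[LHS]subr0 -[X in _ - X](pcoef0 F t).
rewrite -(g_id (fun i => proj high (p e i))) pcoef_eval -sumrB.
by apply: eq_bigr => w _; rewrite -mulrBr.
Qed.

Hypothesis g_short : forall w, w \in msupp g -> (wsize w < k)%N.

Lemma identity_negligible : negligible (fun e => na_eval (p e) g).
Proof.
have [q0 _ _] := admissible_eval g qp.
have nonlate t e : ~~ late t -> pcoef t (na_eval (p e) g) = 0.
  move=> nlt; have [off|[t' ->]|[t' Dt]] := basis_cover t.
  - exact: q0.
  - exact: pcoef_low.
  rewrite (negPf nlt) orbF Dt pcoef_high => lt.
  by rewrite big1 // => w _; rewrite defect_letter ?mulr0.
split=> // t; have zero : (forall e, pcoef t (na_eval (p e) g) = 0) ->
    altsum set0 (fun e => pcoef t (na_eval (p e) g)) = 0.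
  by move=> /eq_altsum ->; exact: altsum0.
have [lt|nlt] := boolP (late t); last by apply: zero => e; exact: nonlate.
have [off|[t' Dt]|[t' -> _]] := basis_cover t.
- by apply: zero => e; exact: q0.
- by apply: zero => e; rewrite Dt; exact: pcoef_low.
rewrite (eq_altsum _ (pcoef_high t')) altsum_sum big_seq big1 // => w gw.
(* At [set0] the condition in [lowdeg] reads 0 + [wsize w] < k. *)
by rewrite altsumZ lowdeg_defect ?mulr0 // cards0 g_short.
Qed.

End ShortIdentities.

(** * The witness and its value in P_3 *)

Section Refutation.
Variables (F : fieldType) (N : nat).
Local Notation k := N.+1.
Local Notation E := {set 'I_k}.

Definition v0 : 'I_3 := ord0.
Definition v1 : 'I_3 := lift ord0 ord0.
Definition v2 : 'I_3 := ord_max.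

(** With this value of y, the letter a_ij of an edge acts as the matrix unit E_ij
    ([edge_mx_pvec]). *)
Definition edge_sum : Palg F 3 :=
  of_pcoef (fun t => if t is Pb i j then (edge i j)%:R else 0).

(** Variables 0 to 5 are y, a, l, b, c, z in the order of [witness]; from 6 on come the switched
    loops. For j >= k, [inord j] defaults to [ord0]. *)
Definition point (e : E) (i : nat) : Palg F 3 :=
  match i with
  | 0 => edge_sum
  | 1 => pvec F (Pa v0 v1)
  | 2 => pvec F (Pa v1 v1)
  | 3 => pvec F (Pa v1 v2)
  | 4 => pvec F (Pa v2 v2)
  | 5 => pvec F (Pc v0)
  | j.+4.+2 => (inord j \in e)%:R *: pvec F (Pa v1 v1)
  end.

Definition witness : freeNA F :=
  hall (var F 0) (var F 1) (var F 2) (var F 3) (var F 4) (var F 5)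
    (map (var F) (iota 6 k)).

Lemma witness_identity : identity (Palg F 2) witness.
Proof. by move=> q; rewrite na_eval_hall hall_identity. Qed.

Lemma admissible_cst (x : Palg F 3) : (forall t, offedge t -> pcoef t x = 0) ->
  admissible (fun _ : E => x).
Proof.
move=> off; split=> [t e /off //|t _|t _]; first by exists (pcoef t x).
by apply: const_affine; exists (pcoef t x).
Qed.

Lemma admissible_point i : admissible (point^~ i).
Proof.
have pvec_admissible t : ~~ offedge t -> admissible (fun _ : E => pvec F t).
  move=> on; apply: admissible_cst => u off; rewrite pcoef_pvec.
  by case: eqP on => // ->; rewrite off.
case: i => [|[|[|[|[|[|i]]]]]]; try exact: pvec_admissible.
  apply: admissible_cst => t; rewrite pcoef_of_pcoef.
  by case: t => //= i j /negPf ->.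
rewrite /point; split=> [t e off|t|t _].
- rewrite pcoefZ pcoef_pvec; case: eqP off => [<- //|_ _]; exact: mulr0.
- rewrite /rigid => r; apply: const0 => e; rewrite pcoefZ pcoef_pvec.
  case: eqP r => [<- //|_ _]; exact: mulr0.
exists 0, (fun j => (inord i == j)%:R * (Pa v1 v1 == t)%:R) => e.
rewrite add0r pcoefZ pcoef_pvec -mulr_suml; congr (_ * _).
have [ie|ie] := boolP (_ \in e).
  rewrite (bigD1 (inord i)) //= eqxx big1 ?addr0 // => j.
  by rewrite eq_sym => /andP[_ /negPf ->].
rewrite big1 // => j je; case: eqP => // ij.
by rewrite ij je in ie.
Qed.

Definition unit_row (i : 'I_3) : 'rV[F]_3 := delta_mx 0 i.

Lemma edge_mx_pvec (c : F) (i j : 'I_3) : edge i j ->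
  edge_mx edge_sum (c *: pvec F (Pa i j)) = c *: delta_mx i j.
Proof.
move=> ij; apply/matrixP => i' j'; rewrite !mxE !pcoefZ !pcoef_pvec !pcoef_of_pcoef.
have -> : (Pa i j == Pa i' j') = (i' == i) && (j' == j).
  by apply/eqP/andP => [[-> ->]|[/eqP-> /eqP->]]; rewrite ?eqxx.
rewrite mulr0 subr0 -mulrA; congr (_ * _).
by case: eqP => [->|_]; case: eqP => [->|_]; rewrite ?ij ?mul0r ?mulr1.
Qed.

Lemma unit_row_edge i j i' : unit_row i *m delta_mx i' j =
  (i == i')%:R *: unit_row j.
Proof.
rewrite /unit_row; have [->|ne] := eqVneq; first by rewrite mul_delta_mx scale1r.
by rewrite mul_delta_mx_0 // scale0r.
Qed.

Lemma pcoef_witness e :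
  pcoef (Pc v2) (na_eval (point e) witness) = - \prod_i (i \in e)%:R.
Proof.
rewrite na_eval_hall !na_eval_var.
have -> : map (na_eval (point e)) (map (var F) (iota 6 k)) =
    [seq (i \in e)%:R *: pvec F (Pa v1 v1) | i <- enum 'I_k].
  rewrite -map_comp (iotaDl 6 0) -map_comp -val_enum_ord -map_comp.
  apply: eq_map => i /=; rewrite na_eval_var /=.
  by rewrite inord_val.
set s := map _ _; pose M := foldr (fun x M => M *m edge_mx edge_sum x) 1%:M s.
pose ML L := foldr (fun x M => M *m edge_mx edge_sum x) (1%:M : 'M[F]_3)
  [seq (i \in e)%:R *: pvec F (Pa v1 v1) | i <- L].
have ML0 L : unit_row v0 *m ML L = (nilp L)%:R *: unit_row v0.
  elim: L => [|i L IHL]; first by rewrite mulmx1 scale1r.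
  rewrite /ML /= mulmxA IHL edge_mx_pvec // -scalemxAl -scalemxAr unit_row_edge.
  by rewrite !scale0r !scaler0.
have ML1 L : unit_row v1 *m ML L = (\prod_(i <- L) (i \in e)%:R) *: unit_row v1.
  elim: L => [|i L IHL]; first by rewrite mulmx1 big_nil scale1r.
  rewrite /ML /= mulmxA IHL edge_mx_pvec // -scalemxAl -scalemxAr unit_row_edge.
  by rewrite eqxx scale1r scalerA big_cons mulrC.
(* Since k = [N.+1] is positive, at least one loop at 1 is present, and it kills the row of vertex
   0. *)
have M0 : unit_row v0 *m M = 0.
  by rewrite [LHS]ML0 /nilp size_enum_ord scale0r.
have M1 : unit_row v1 *m M = (\prod_i (i \in e)%:R) *: unit_row v1.
  by rewrite [LHS]ML1 big_enum.
have edge1 (i j : 'I_3) : edge i j ->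
    edge_mx edge_sum (pvec F (Pa i j)) = delta_mx i j.
  by move=> ij; rewrite -[pvec _ _]scale1r edge_mx_pvec // scale1r.
have z0 : cvec (pvec F (Pc v0)) = unit_row v0.
  apply/rowP => j; rewrite !mxE pcoef_pvec eqxx /= eq_sym; congr (nat_of_bool _)%:R.
have hallE : cvec (opHall edge_sum (pvec F (Pa v0 v1)) (pvec F (Pa v1 v1))
    (pvec F (Pa v1 v2)) (pvec F (Pa v2 v2)) s (pvec F (Pc v0))) =
    - (\prod_i (i \in e)%:R) *: unit_row v2.
  rewrite (opHall_acts _ _ _ _ (opN_acts _ _)) z0 -/M !edge1 //.
  have rowC (v : 'rV_3) (A B : 'M[F]_3) : v *m mxC A B = v *m B *m A - v *m A *m B.
    by rewrite mulmxBr !mulmxA.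
  have rowJ (v : 'rV_3) (A B : 'M[F]_3) : v *m mxJ A B = v *m B *m A + v *m A *m B.
    by rewrite mulmxDr !mulmxA.
  (* From vertex 0 only E_01 M E_11 E_12 E_22 survives; the two inner commutators and the outer one
     contribute a sign each. *)
  have D10 : unit_row v0 *m mxC (delta_mx v0 v1) M =
      - (\prod_i (i \in e)%:R) *: unit_row v1.
    by rewrite rowC M0 mul0mx unit_row_edge scale1r M1 sub0r scaleNr.
  have D20 : unit_row v0 *m mxC (delta_mx v1 v1) (delta_mx v1 v2) = 0.
    by rewrite rowC !unit_row_edge !scale0r !mul0mx subrr.
  have D21 : unit_row v1 *m mxC (delta_mx v1 v1) (delta_mx v1 v2) = - unit_row v2.
    by rewrite rowC !unit_row_edge !scale1r !unit_row_edge scale0r scale1r sub0r.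
  rewrite rowC unit_row_edge scale0r mul0mx sub0r.
  rewrite rowJ D20 mul0mx D10 add0r -scalemxAl D21.
  by rewrite -scalemxAl mulNmx unit_row_edge scale1r scalerN opprK.
(* The two outer factors carry c_2 to e_22 and back to c_2, so the coordinate is preserved. *)
have /rowP/(_ v2) := hallE; rewrite !mxE eqxx mulr1 => <-.
rewrite /hall pcoef_Pc (bigD1 v2) //= big1 => [|i ne]; last first.
  rewrite !pcoef_pvec; have /negPf -> : Pa v2 v2 != Pa i v2 :> Pbasis 3.
    by apply: contra ne => /eqP[->].
  by rewrite !mulr0 !subr0 addr0.
by rewrite !pcoef_pvec eqxx pcoef_Pe pcoef_of_pcoef !mulr0 mulr1
   mul1r !subr0 add0r addr0.
Qed.

End Refutation.

Theorem theorem6p3 (F : fieldType) :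
  ~ exists s : seq (freeNA F), identity_basis (Palg F 2) (fun f => f \in s).
Proof.
move=> [s [s_id s_basis]].
pose N := (\max_(f <- s) \max_(w <- msupp f) wsize w)%N.
(* A T-ideal that separates s from the witness: [N] bounds the degrees in s, and the witness has
   [N.+1] switched loops. *)
pose I (g : freeNA F) := forall p : {set 'I_N.+1} -> nat -> Palg F 3,
  (forall i, admissible (fun e => p e i)) -> negligible (fun e => na_eval (p e) g).
have IT : is_T_ideal I.
  split; first split.
  - by move=> p qp; apply: (eq_inJ _ (negligible0 F N.+1)) => e; rewrite na_eval0.
  - move=> x y Ix Iy p qp; apply: (eq_inJ _ (negligibleD (Ix p qp) (Iy p qp))) => e.
    by rewrite na_evalD.
  - move=> a x Ix p qp; apply: (eq_inJ _ (negligibleZ a (Ix p qp))) => e.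
    by rewrite na_evalZ.
  - move=> x y Ix; split=> p qp;
      have [J1 J2] := negligible_ideal (admissible_eval y qp) (Ix p qp).
      by apply: (eq_inJ _ J2) => e; rewrite na_evalM.
    by apply: (eq_inJ _ J1) => e; rewrite na_evalM.
  move=> phi phiM f If p qp.
  apply: (eq_inJ _ (If (fun e i => na_eval (p e) (phi (var F i))) _)) => [e|i].
    by rewrite na_eval_subst.
  exact: admissible_eval.
have sI g : g \in s -> I g.
  move=> gs p qp; apply: identity_negligible => // [|w gw]; first exact: s_id.
  rewrite ltnS /N; apply: leq_trans (leq_bigmax_seq _ gs _) => //.
  exact: leq_bigmax_seq.
have [_ /(_ (Pc v2))] :=
  s_basis _ (@witness_identity F N) I IT sI _ (@admissible_point F N).
rewrite (eq_altsum _ (@pcoef_witness F N)).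
rewrite (@eq_altsum _ _ _ _ (fun e => -1 * \prod_i (i \in e)%:R)) => [|e].
  rewrite altsumZ mulN1r => /eqP; rewrite oppr_eq0.
  exact/negP/altsum_prod_mem.
by rewrite mulN1r.
Qed.
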